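(* For every integer $n\ge 1$, $$r_{2,n}(q)=r_{1,n}(q)^2+\bigl(q^{n+1}-1\bigr)\,q^{n+2}\,r_{2,n-1}(q),$$ or equivalently, for every integer $n\ge 0$, $$r_{2,n}(q)=f(n,q)\sum_{j=0}^{n}\frac{r_{1,j}(q)^2}{f(j,q)},\qquad\text{where } f(n,q)=(q-1)^{n+1}\,[n+1]!\;q^{\frac{(n+1)(n+4)}{2}}.$$
   Context: Let $q$ be an indeterminate. Set $a(n,q)=q^{\binom n2}$ for integers $n\ge 0$ and $a(n,q)=0$ for integers $n<0$. For integers $m\ge 0$ and $n\ge 1$ define the Hankel determinant $$D_{-m,n}(q)=\det\bigl(a(-m+i+j,q)\bigr)_{i,j=0}^{n-1},$$ and set $D_{-m,0}(q)=1$. The determinant $D_{0,n+1}(q)$ is a nonzero polynomial for every $n\ge 0$, so for integers $m,n\ge 0$ a rational function $r_{m,n}(q)$ is uniquely determined by $$D_{-m,n+m+1}(q)=(-1)^{\binom{m+1}{2}}\,r_{m,n}(q)\,q^{m\binom n2}\,D_{0,n+1}(q).$$ Notation: $[n]=1+q+\cdots+q^{n-1}=\frac{q^n-1}{q-1}$ and $[n]!=[1][2]\cdots[n]$, with $[0]!=1$. *)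

(* Defs.v *)
From HB Require Import structures.
From mathcomp Require Import all_boot all_order all_algebra.
From mathcomp Require Import zify.
Set Implicit Arguments.
Unset Strict Implicit.
Unset Printing Implicit Defensive.
Import Order.TTheory GRing.Theory Num.Theory.
Local Open Scope ring_scope.

(* All notions are defined for an element q of a field; they are meant for
   q = [qX], the indeterminate of the field Q(q). *)

Definition ratfun : fieldType := {fraction {poly rat}}.

Definition qX : ratfun := @FracField.tofrac {poly rat} 'X.

Definition a (K : fieldType) (q : K) (k : int) : K :=
  if k is Posz n then q ^+ 'C(n, 2) else 0.

(* [D q k n] is D_{k,n}(q); for n = 0 it is the empty determinant, which is 1. *)
Definition D (K : fieldType) (q : K) (k : int) (n : nat) : K :=
  \det (\matrix_(i < n, j < n) a q (k + i%:Z + j%:Z)).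

(* The solution r_{m,n}(q) of
     D_{-m,n+m+1} = (-1)^C(m+1,2) r_{m,n} q^(m C(n,2)) D_{0,n+1};
   that it is one, and the only one, is [r_spec] and [r_uniq] below. *)
Definition r (K : fieldType) (q : K) (m n : nat) : K :=
  D q (- m%:Z) (n + m + 1) /
    ((-1) ^+ 'C(m.+1, 2) * q ^+ (m * 'C(n, 2)) * D q 0 n.+1).

Definition qint (K : fieldType) (q : K) (n : nat) : K := \sum_(i < n) q ^+ i.

Definition qfact (K : fieldType) (q : K) (n : nat) : K :=
  \prod_(1 <= i < n.+1) qint q i.

(* (n + 1)(n + 4) is even, so the division in the exponent is exact. *)
Definition f (K : fieldType) (q : K) (n : nat) : K :=
  (q - 1) ^+ n.+1 * qfact q n.+1 * q ^+ ((n + 1) * (n + 4) %/ 2).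

Lemma qX_neq0 : qX != 0.
Proof. by rewrite /qX tofrac_eq0 polyX_eq0. Qed.

Lemma expqX_inj : injective (fun n => qX ^+ n).
Proof.
move=> i j /eqP; rewrite /qX -!tofracXn tofrac_eq => /eqP e.
have := size_polyXn rat i; rewrite e size_polyXn.
by case.
Qed.

Lemma D0_neq0 (K : fieldType) (q : K) (q0 : q != 0)
  (qI : injective (fun n => q ^+ n)) n : D q 0 n != 0.
Proof.
pose d : 'rV[K]_n := \row_i q ^+ 'C(i, 2).
have -> : D q 0 n = \det (diag_mx d *m Vandermonde n (\row_j q ^+ j) *m diag_mx d).
  congr (\det _); apply/matrixP => i j.
  rewrite mul_mx_diag mul_diag_mx !mxE add0r -PoszD /= -exprM -!exprD.
  congr (q ^+ _); rewrite [(j * i)%N]mulnC -addnA.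
  elim: {i}(i : nat) => [|i IH]; first by rewrite bin0n add0n mul0n.
  by rewrite addSn !binS !bin1 IH; lia.
rewrite !det_mulmx det_diag det_Vandermonde !mulf_neq0 //;
  try by apply/prodf_neq0 => i _; rewrite mxE expf_neq0.
apply/prodf_neq0 => i _; apply/prodf_neq0 => j ij.
rewrite !mxE subr_eq0; apply/eqP => /qI e.
by rewrite e ltnn in ij.
Qed.

Lemma r_charact (K : fieldType) (q : K) (q0 : q != 0)
  (qI : injective (fun n => q ^+ n)) (m n : nat) (x : K) :
  D q (- m%:Z) (n + m + 1) =
    (-1) ^+ 'C(m.+1, 2) * x * q ^+ (m * 'C(n, 2)) * D q 0 n.+1
  <-> x = r q m n.
Proof.
have d0 := D0_neq0 q0 qI n.+1; rewrite /r.
set c := (-1) ^+ _; set e := q ^+ _.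
have c0 : c != 0 by rewrite /c signr_eq0.
have e0 : e != 0 by rewrite /e expf_neq0.
have u0 : c * e * D q 0 n.+1 != 0 by rewrite !mulf_neq0.
rewrite [c * x]mulrC -!mulrA [c * _]mulrA; split=> [->|->].
  by rewrite mulfK.
by rewrite divfK.
Qed.

Lemma r_spec (m n : nat) :
  D qX (- m%:Z) (n + m + 1) =
    (-1) ^+ 'C(m.+1, 2) * r qX m n * qX ^+ (m * 'C(n, 2)) * D qX 0 n.+1.
Proof. by apply/(r_charact qX_neq0 expqX_inj). Qed.

Lemma r_uniq (m n : nat) (x : ratfun) :
  D qX (- m%:Z) (n + m + 1) =
    (-1) ^+ 'C(m.+1, 2) * x * qX ^+ (m * 'C(n, 2)) * D qX 0 n.+1 ->
  x = r qX m n.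
Proof. by move/(r_charact qX_neq0 expqX_inj). Qed.

Lemma f_neq0_gen (K : fieldType) (q : K) (q0 : q != 0)
  (qI : injective (fun n => q ^+ n)) n : f q n != 0.
Proof.
have qn1 k : q ^+ k.+1 - 1 != 0.
  by rewrite subr_eq0 -(expr0 q); apply/eqP => /qI.
rewrite /f !mulf_neq0 ?expf_neq0 //; first exact: (qn1 0%N).
rewrite /qfact big_add1 big_mkord; apply/prodf_neq0 => i _.
by apply: contraNneq (qn1 i) => e; rewrite subrX1 -/(qint q _) e mulr0.
Qed.

Lemma f_neq0 n : f qX n != 0.
Proof. exact: f_neq0_gen qX_neq0 expqX_inj n. Qed.

(* Main.v *)
(* The Desnanot-Jacobi identity applied to the Hankel matrix of D_{-2,n+3} gives
     D_{-2,n+3} D_{0,n+1} = D_{-2,n+2} D_{0,n+2} - D_{-1,n+2}^2.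
   Writing each factor in terms of r_{2,n}, r_{2,n-1} and r_{1,n} turns this
   into the recursion, since the Vandermonde evaluation of D_{0,n} gives
     D_{0,n} D_{0,n+2} / D_{0,n+1}^2 = q^(3n) (q^(n+1) - 1).
   The closed form follows by induction: f(n) satisfies the homogeneous
   recursion. *)
Require Import Defs.
From mathcomp Require Import all_boot all_order all_algebra.
From mathcomp Require Import zify ring.
Import GRing.Theory.
Local Open Scope ring_scope.

(** Column 1 is a unit vector unless it is the last one, so expanding along it deletes index 1 and
    leaves a matrix of the same shape. The induction ends at the 2 x 2 corner determinant. *)
Lemma det_id_two_cols (R : comNzRingType) n (u v : nat -> R) :
  \det (\matrix_(i < n.+2, j < n.+2)
          if j == 0 :> nat then u i else if j == n.+1 :> nat then v i
          else (i == j)%:R)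
  = u 0%N * v n.+1 - u n.+1 * v 0%N.
Proof.
elim: n u v => [|n IHn] u v.
  rewrite (expand_det_row _ ord0) !big_ord_recl big_ord0 /cofactor.
  by rewrite !det_mx11 !mxE /=; ring.
pose skip k := bump 1 k.
rewrite (expand_det_col _ (lift ord0 ord0)) (bigD1 (lift ord0 ord0)) //=.
rewrite big1 ?addr0 => [|i ni1]; last by rewrite !mxE /= (negPf ni1) mul0r.
rewrite !mxE /= mul1r /cofactor expr2 mulrNN mulr1 mul1r.
rewrite -[RHS](IHn (u \o skip) (v \o skip)); congr (\det _).
apply/matrixP => i j; rewrite !mxE /= (inj_eq lift_inj).
by case: (j : nat) => [|k].
Qed.

(* Multiplying M by the identity whose extreme columns are replaced by those
   of \adj M gives M with extreme columns (\det M) *: e_0 and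
   (\det M) *: e_last. *)
Lemma desnanot_jacobi_regular (R : comNzRingType) n (M : 'M[R]_n.+2) :
  \det M * (\det M * \det (row' ord_max (col' ord_max (row' ord0 (col' ord0 M)))))
  = \det M * (\det (row' ord0 (col' ord0 M)) * \det (row' ord_max (col' ord_max M))
     - \det (row' ord0 (col' ord_max M)) * \det (row' ord_max (col' ord0 M))).
Proof.
pose B := \matrix_(i < n.+2, j < n.+2)
   if j == 0 :> nat then (\adj M) (inord i) ord0
   else if j == n.+1 :> nat then (\adj M) (inord i) ord_max else (i == j)%:R.
have detB : \det B = \det (row' ord0 (col' ord0 M)) * \det (row' ord_max (col' ord_max M))
     - \det (row' ord0 (col' ord_max M)) * \det (row' ord_max (col' ord0 M)).
  rewrite (det_id_two_cols _ n (fun i => (\adj M) (inord i) ord0)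
            (fun i => (\adj M) (inord i) ord_max)).
  have -> : inord 0 = ord0 :> 'I_n.+2 by apply/val_inj; rewrite /= inordK.
  have -> : inord n.+1 = ord_max :> 'I_n.+2 by apply/val_inj; rewrite /= inordK.
  (* The four entries of [\adj M] are corner cofactors. The signs of the two mixed ones are equal
     and cancel in their product. *)
  rewrite !mxE /cofactor /= !addn0 add0n expr0 mul1r.
  rewrite addnn -muln2 exprM sqrr_sign mul1r; congr (_ - _).
  by rewrite mulrACA -expr2 sqrr_sign mul1r.
have MBE : M *m B = \matrix_(i, j)
   if j == 0 :> nat then \det M *+ (i == ord0)
   else if j == n.+1 :> nat then \det M *+ (i == ord_max) else M i j.
  apply/matrixP => i j; rewrite !mxE.
  under eq_bigr => k _ do rewrite mxE inord_val.
  case: ifP => _; last case: ifP => _.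
  - by have /matrixP/(_ i ord0) := mul_mx_adj M; rewrite !mxE.
  - by have /matrixP/(_ i ord_max) := mul_mx_adj M; rewrite !mxE.
  - rewrite (bigD1 j) //= eqxx mulr1 big1 ?addr0 // => k /negPf ->.
    by rewrite mulr0.
rewrite -detB -det_mulmx MBE [RHS](expand_det_col _ ord0) (bigD1 ord0) //=.
rewrite big1 ?addr0 => [|i /negPf i0]; last by rewrite mxE /= i0 mul0r.
rewrite !mxE /= /cofactor expr0 mul1r; congr (_ * _).
rewrite [RHS](expand_det_col _ ord_max) (bigD1 ord_max) //= big1 ?addr0; last first.
  move=> i; rewrite -val_eqE /= => /negPf im.
  by rewrite !mxE /= -val_eqE /= eqxx /bump /= eqSS im mul0r.
rewrite !mxE /= -val_eqE /= /bump /= eqxx /cofactor /=.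
rewrite addnn -muln2 exprM sqrr_sign mul1r; congr (_ * \det _).
apply/matrixP => i j; rewrite !mxE /= /bump leq0n add1n eqSS.
by rewrite leqNgt ltn_ord add0n ltn_eqF // ltn_ord.
Qed.

(* The factor \det M is cancelled for 'X + M, whose determinant is monic, before
   evaluating at 0. *)
Lemma desnanot_jacobi (R : comNzRingType) n (M : 'M[R]_n.+2) :
  \det M * \det (row' ord_max (col' ord_max (row' ord0 (col' ord0 M))))
  = \det (row' ord0 (col' ord0 M)) * \det (row' ord_max (col' ord_max M))
    - \det (row' ord0 (col' ord_max M)) * \det (row' ord_max (col' ord0 M)).
Proof.
have /monic_lreg reg := char_poly_monic (- M).
have := desnanot_jacobi_regular _ _ (char_poly_mx (- M)).
move/reg/(congr1 (horner_eval 0)).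
rewrite rmorphB !rmorphM /= -!det_map_mx => e.
apply: etrans (etrans _ e) _;
  [congr (_ * _) | congr (_ * _ - _ * _)];
  congr (\det _); apply/matrixP => i j; rewrite !mxE /= /horner_eval;
  by rewrite hornerD hornerN hornerC hornerMn hornerX mul0rn sub0r opprK.
Qed.

Lemma binomialD2 (i j : nat) : 'C(i + j, 2) = ('C(i, 2) + i * j + 'C(j, 2))%N.
Proof.
elim: i => [|i IHi]; first by rewrite bin0n.
by rewrite addSn !binS !bin1 IHi; lia.
Qed.

(** Deleting the first row or column of a Hankel matrix raises the index by 1, deleting the last one
    keeps it. Hence the two mixed minors coincide, which gives the square. *)
Lemma D_condensation (K : fieldType) (q : K) (k : int) (n : nat) :
  D q k n.+2 * D q (k + 2) n
  = D q k n.+1 * D q (k + 2) n.+1 - D q (k + 1) n.+1 ^+ 2.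
Proof.
have := desnanot_jacobi _ _ (\matrix_(i < n.+2, j < n.+2) a q (k + i%:Z + j%:Z)).
rewrite [X in X - _]mulrC expr2 => e.
apply: etrans (etrans _ e) _;
  [congr (_ * _) | congr (_ * _ - _ * _)]; congr (\det _);
  apply/matrixP => i j; rewrite !mxE /= /bump ?leq0n ?[(_ <= nat_of_ord _)%N]leqNgt;
  rewrite ?ltn_ord; congr (a q _); lia.
Qed.

(* D_{0,n} is the Vandermonde determinant of 1, q, ..., q^(n-1), scaled by
   diagonal matrices: binom(i + j, 2) = binom(i, 2) + i j + binom(j, 2). *)
Lemma D0E (K : fieldType) (q : K) (n : nat) :
  D q 0 n = \prod_(j < n) (q ^+ 'C(j, 2) ^+ 2 * \prod_(i < j) (q ^+ j - q ^+ i)).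
Proof.
pose d : 'rV[K]_n := \row_i q ^+ 'C(i, 2).
have -> : D q 0 n = \det (diag_mx d *m Vandermonde n (\row_j q ^+ j) *m diag_mx d).
  congr (\det _); apply/matrixP => i j.
  rewrite mul_mx_diag mul_diag_mx !mxE add0r -PoszD /= -exprM -!exprD.
  by rewrite [(j * i)%N]mulnC binomialD2.
rewrite !det_mulmx det_diag det_Vandermonde big_split prodrXl mulrAC -expr2 /=.
congr (_ ^+ 2 * _); first by apply: eq_bigr => i _; rewrite mxE.
rewrite (exchange_big_dep xpredT) //=; apply: eq_bigr => j _.
rewrite (big_ord_widen n (fun i => q ^+ j - q ^+ i)) 1?ltnW //.
by apply: eq_bigr => i _; rewrite !mxE.
Qed.

Lemma D0_ratio (K : fieldType) (q : K) (n : nat) :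
  D q 0 n.+2 * D q 0 n = q ^+ (3 * n) * (q ^+ n.+1 - 1) * D q 0 n.+1 ^+ 2.
Proof.
have shift : \prod_(i < n.+1) (q ^+ n.+1 - q ^+ i)
    = (q ^+ n.+1 - 1) * q ^+ n * \prod_(i < n) (q ^+ n - q ^+ i).
  (* The factor for [i = 0] is split off; each of the others is [q] times a factor on the right. *)
  rewrite big_ord_recl -mulrA; congr (_ * _).
  transitivity (\prod_(i < n) (q * (q ^+ n - q ^+ i))).
    by apply: eq_bigr => i _; rewrite /= !exprS mulrBr.
  by rewrite big_split /= prodr_const card_ord.
have D0S m : D q 0 m.+1
    = D q 0 m * (q ^+ 'C(m, 2) ^+ 2 * \prod_(i < m) (q ^+ m - q ^+ i)).
  by rewrite !D0E big_ord_recr.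
rewrite (D0S n.+1) (D0S n) shift binS bin1 exprD.
by rewrite mulnC exprM; ring.
Qed.

Lemma r2_rec (K : fieldType) (q : K) (q0 : q != 0)
  (qI : injective (fun n => q ^+ n)) (n : nat) :
  r q 2 n.+1 = r q 1 n.+1 ^+ 2 + (q ^+ n.+2 - 1) * q ^+ n.+3 * r q 2 n.
Proof.
have := D_condensation _ q (- 2%:Z) n.+2.
rewrite (_ : - 2%:Z + 2 = 0) // (_ : - 2%:Z + 1 = - 1%:Z) //.
have rE m k : D q (- m%:Z) (k + m + 1)
    = (-1) ^+ 'C(m.+1, 2) * r q m k * q ^+ (m * 'C(k, 2)) * D q 0 k.+1.
  by apply/r_charact.
move: (rE 2 n.+1) (rE 2 n) (rE 1 n.+1).
rewrite !addn1 !addn2 => -> -> ->.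
rewrite (_ : 'C(2, 2) = 1%N) // (_ : 'C(3, 2) = 3) // binS bin1 => e.
have d2 := D0_neq0 q0 qI n.+2.
(* Since ['C(n.+1, 2) = 'C(n, 2) + n], this is the factor that multiplies the square of [r q 1 n.+1]
   in [e]. *)
have c0 : q ^+ 'C(n, 2) ^+ 2 * q ^+ n ^+ 2 * D q 0 n.+2 ^+ 2 != 0.
  by rewrite !mulf_neq0 // !expf_neq0 // q0.
apply: (mulfI c0); move: e (D0_ratio _ q n.+1).
(* The part [n * 2] belongs to the common factor; [n.+3] is the exponent in the recursion. *)
rewrite mul1n (_ : (3 * n.+1 = n * 2 + n.+3)%N); last lia.
rewrite ![(2 * _)%N]mulnC !mulnDl !exprD !exprM.
set d1 := D q 0 n.+1; set d3 := D q 0 n.+3; set dd := D q 0 n.+2.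
set x := q ^+ 'C(n, 2); set y := q ^+ n; set z := q ^+ n.+3; set w := q ^+ n.+2.
set s := r q 2 n; set s' := r q 2 n.+1; set t := r q 1 n.+1.
move=> e1 e2.
have -> : x ^+ 2 * y ^+ 2 * dd ^+ 2 * (t ^+ 2 + (w - 1) * z * s)
  = x ^+ 2 * y ^+ 2 * dd ^+ 2 * t ^+ 2 + x ^+ 2 * s * (y ^+ 2 * z * (w - 1) * dd ^+ 2).
  by ring.
(* Both terms with index -2 carry the sign [(-1) ^+ 3], hence the negation. *)
by rewrite -e2; apply: oppr_inj; apply: etrans (etrans _ e1) _; ring.
Qed.

Lemma f_rec (K : fieldType) (q : K) (n : nat) :
  f q n.+1 = (q ^+ n.+2 - 1) * q ^+ n.+3 * f q n.
Proof.
have e : ((n.+1 + 1) * (n.+1 + 4) %/ 2 = n.+3 + (n + 1) * (n + 4) %/ 2)%N.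
  by rewrite -divnMDl //; congr (_ %/ _)%N; lia.
rewrite /f e subrX1 -/(qint q _) /qfact big_nat_recr //= exprD [_ ^+ n.+2]exprS.
by ring.
Qed.

(** The term with [r q 2 (n - 1)] has no counterpart at [n = 0]: condensation yields
    [D q (- 2%:Z) 2] in its place, and its first row a(-2), a(-1) vanishes. *)
Lemma r2_0 (K : fieldType) (q : K) : r q 2 0 = r q 1 0 ^+ 2.
Proof.
have D01 : D q 0 1 = 1 by rewrite D0E big_ord_recl !big_ord0 /= expr1n !mulr1.
have D22 : D q (- 2%:Z) 2 = 0.
  rewrite /D (expand_det_row _ ord0) !big_ord_recl big_ord0 !mxE /=.
  by rewrite !mul0r !addr0.
have := D_condensation _ q (- 2%:Z) 1.
rewrite (_ : - 2%:Z + 2 = 0) // (_ : - 2%:Z + 1 = - 1%:Z) // D01 D22 => e.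
rewrite /r D01 !muln0 !expr0 !mulr1 -[D q _ (0 + 2 + 1)]mulr1 e.
rewrite (_ : 'C(2, 2) = 1%N) // (_ : 'C(3, 2) = 3) //.
by rewrite expr1 (exprS _ 2) sqrrN expr1n mulr1 invrN1; ring.
Qed.

Lemma r2_sum (K : fieldType) (q : K) (q0 : q != 0)
  (qI : injective (fun n => q ^+ n)) (n : nat) :
  r q 2 n = f q n * \sum_(0 <= j < n.+1) r q 1 j ^+ 2 / f q j.
Proof.
have f0 := f_neq0_gen q0 qI.
elim: n => [|n IHn]; first by rewrite big_nat1 mulrC divfK // r2_0.
rewrite big_nat_recr //= mulrDr [f q n.+1 * (_ / _)]mulrC divfK //.
by rewrite r2_rec // IHn f_rec; ring.
Qed.

Theorem theorem2 :
  (forall n : nat, (1 <= n)%N ->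
     r qX 2 n = r qX 1 n ^+ 2
                + (qX ^+ (n + 1) - 1) * qX ^+ (n + 2) * r qX 2 (n - 1)) /\
  (forall n : nat,
     r qX 2 n = f qX n * \sum_(0 <= j < n.+1) r qX 1 j ^+ 2 / f qX j).
Proof.
split=> [[|n] // _|n]; last exact: r2_sum qX_neq0 expqX_inj n.
rewrite addn1 addn2 subn1; exact: r2_rec qX_neq0 expqX_inj n.
Qed.
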